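(* Let $A\subseteq\mathbb{R}_1^2$ be a nonempty finite subset of the Manhattan plane $\mathbb{R}_1^2=(\mathbb{R}^2,d_1)$. Then the tight span $T(A)$ of the metric space $(A,d_1|_A)$ can be constructed by the following procedure (i.e. the procedure can be carried out, it stops after finitely many steps, and the set produced in Step 6, with the metric induced from $d_1$, is isometric to $T(A)$). **Step 1.** Choose the point $(a,b)\in A$ with the smallest ordinate; if there are several such points, choose the one with the smallest abscissa. Set $\mathrm{SPINE}:=\{(a,b)\}$. **Step 2.** If there is no point of $A$ with ordinate greater than $b$, go to Step 5. **Step 3.** (i) If there is a point $(x_1,y_1)\in A$ with $y_1>b$ and $x_1\ge a$, and there is a point $(x_2,y_2)\in A$ with $y_2>b$ and $x_2\le a$, let $$t=\min\bigl\{\max\{y-b \mid (x,y)\in A,\ y>b,\ x\ge a\},\ \max\{y-b\mid (x,y)\in A,\ y>b,\ x\le a\}\bigr\},$$ replace $\mathrm{SPINE}$ by $\mathrm{SPINE}\cup[(a,b),(a,b+t)]$, and then set $b:=b+t$. (ii) If there is a point $(x_1,y_1)\in A$ with $y_1>b$ and $x_1\ge a$, but there is no point $(x,y)\in A$ with $y>b$ and $x\le a$, let $$t=\min\{x-a\mid (x,y)\in A,\ y>b,\ x\ge a\},$$ replace $\mathrm{SPINE}$ by $\mathrm{SPINE}\cup[(a,b),(a+t,b)]$, and then set $a:=a+t$. (iii) If there is a point $(x_1,y_1)\in A$ with $y_1>b$ and $x_1\le a$, but there is no point $(x,y)\in A$ with $y>b$ and $x\ge a$, let $$t=\min\{a-x\mid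 (x,y)\in A,\ y>b,\ x\le a\},$$ replace $\mathrm{SPINE}$ by $\mathrm{SPINE}\cup[(a-t,b),(a,b)]$, and then set $a:=a-t$. (Exactly one of the cases (i), (ii), (iii) is executed, for the current value of $(a,b)$.) **Step 4.** Go to Step 2. **Step 5.** Connect the points of $A$ with horizontal segments to the $\mathrm{SPINE}$: for each $p=(x,y)\in A$, add the horizontal segment from $p$ to the nearest point of $\mathrm{SPINE}$ on the horizontal line through $p$ (the segment is degenerate if $p\in\mathrm{SPINE}$). Call the resulting set, i.e. the union of $\mathrm{SPINE}$ and all these segments, the $\mathrm{SKELETON}$. **Step 6.** Apply the vertical hatching operation to the $\mathrm{SKELETON}$, giving the set $L_y(\mathrm{SKELETON})\subseteq\mathbb{R}_1^2$. The resulting set $L_y(\mathrm{SKELETON})$, with the metric induced from $d_1$, is isometric to the tight span $T(A)$ of $A$.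
   Context: **Manhattan plane.** $\mathbb{R}_1^2=(\mathbb{R}^2,d_1)$ with $d_1((x_1,y_1),(x_2,y_2))=|x_1-x_2|+|y_1-y_2|$. Subsets of $\mathbb{R}_1^2$ carry the restriction of $d_1$. The abscissa and ordinate of $(x,y)$ are $x$ and $y$. For points $p,q$ on a common horizontal or vertical line, $[p,q]$ denotes the line segment between $p$ and $q$. **Vertical hatching.** For $S\subseteq\mathbb{R}^2$ and $x_0\in\mathbb{R}$, let $S_{x_0}=S\cap\{(x,y)\mid x=x_0\}$. For a set $X$ lying on a vertical line, let $[X]$ denote the minimal segment (possibly empty or infinite) contained in that line and containing $X$. The vertical hatching (hatching in the $y$-direction) of $S$ is $$L_y(S)=\bigcup_{x\in\mathbb{R}}[S_x].$$ **Tight span.** For a metric space $(X,d)$, the tight span $T(X)$ is the set of all pointwise minimal functions among the functions $f:X\to\mathbb{R}^{\ge 0}$ satisfying $f(p)+f(q)\ge d(p,q)$ for all $p,q\in X$ (i.e. $f$ satisfies this condition, and no $g\neq f$ satisfying the same condition has $g(p)\le f(p)$ for all $p\in X$). It is equipped with the supremum metric $d_\infty(f,g)=\sup_{p\in X}|f(p)-g(p)|$. *)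

(* Defs.v *)
From Stdlib Require Export Relation_Operators.
From mathcomp Require Export all_boot all_order all_algebra.
From mathcomp Require Export all_classical all_reals all_analysis.

Set Implicit Arguments.
Unset Strict Implicit.
Unset Printing Implicit Defensive.

Import Order.TTheory GRing.Theory Num.Theory.
Local Open Scope classical_set_scope.
Local Open Scope ring_scope.

Section Metric.
Variable R : realType.

Definition isometric (U V : Type) (dU : U -> U -> R) (dV : V -> V -> R)
    (S : set U) (T : set V) : Prop :=
  exists2 phi : U -> V, set_bij S T phi &
    forall u v, S u -> S v -> dV (phi u) (phi v) = dU u v.

Definition tight_span_candidate (X : Type) (d : X -> X -> R) (f : X -> R) :=
  (forall p, 0 <= f p) /\ (forall p q, d p q <= f p + f q).

Definition tight_span (X : Type) (d : X -> X -> R) : set (X -> R) :=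
  [set f | tight_span_candidate d f /\
     ~ exists g, [/\ tight_span_candidate d g, g <> f & forall p, g p <= f p]].

(* For X nonempty and f, g in the tight span of a metric on X, the set below is
   nonempty and bounded, so that this real-valued sup is the true supremum. *)
Definition dist_infty (X : Type) (f g : X -> R) : R :=
  sup (range (fun p => `|f p - g p|)).

End Metric.

Section Plane.
Variable R : realType.
Implicit Types (A S : set (R * R)) (p q : R * R).

Definition d1 p q : R := `|p.1 - q.1| + `|p.2 - q.2|.

Definition segment p q : set (R * R) :=
  [set ((1 - l) * p.1 + l * q.1, (1 - l) * p.2 + l * q.2) | l in `[0, 1]].

(* A segment of the line {x} * R, possibly empty or infinite, is {x} * I with I
   an interval of R; the smallest one containing the section of S at x is given
   by the intersection of all such I. *)
Definition vertical_hatching S : set (R * R) :=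
  \bigcup_(x in [set: R]) ([set x] `*` smallest (@is_interval R) (xsection S x)).

Definition is_max (E : set R) (t : R) := E t /\ ubound E t.
Definition is_min (E : set R) (t : R) := E t /\ lbound E t.

Definition start_point A p :=
  A p /\ forall q, A q -> p.2 <= q.2 /\ (q.2 = p.2 -> p.1 <= q.1).

Definition above_right A p : set (R * R) :=
  [set q | [/\ A q, p.2 < q.2 & p.1 <= q.1]].

Definition above_left A p : set (R * R) :=
  [set q | [/\ A q, p.2 < q.2 & q.1 <= p.1]].

(* A state ((a, b), S) holds the current point (a, b) and the current value S
   of the spine. *)
Inductive spine_step A : (R * R) * set (R * R) -> (R * R) * set (R * R) -> Prop :=
| spine_step_up a b S t1 t2 :
    above_right A (a, b) !=set0 -> above_left A (a, b) !=set0 ->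
    is_max [set q.2 - b | q in above_right A (a, b)] t1 ->
    is_max [set q.2 - b | q in above_left A (a, b)] t2 ->
    let t := Num.min t1 t2 in
    spine_step A ((a, b), S)
      ((a, b + t), S `|` segment (a, b) (a, b + t))
| spine_step_right a b S t :
    above_right A (a, b) !=set0 -> ~ (above_left A (a, b) !=set0) ->
    is_min [set q.1 - a | q in above_right A (a, b)] t ->
    spine_step A ((a, b), S)
      ((a + t, b), S `|` segment (a, b) (a + t, b))
| spine_step_left a b S t :
    above_left A (a, b) !=set0 -> ~ (above_right A (a, b) !=set0) ->
    is_min [set a - q.1 | q in above_left A (a, b)] t ->
    spine_step A ((a, b), S)
      ((a - t, b), S `|` segment (a - t, b) (a, b)).

Definition spine_done A p := ~ exists q, A q /\ p.2 < q.2.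

Definition spine_reachable A (s : (R * R) * set (R * R)) :=
  exists2 p, start_point A p &
    clos_refl_trans _ (spine_step A) (p, [set p]) s.

Definition spine A S :=
  exists2 p, spine_reachable A (p, S) & spine_done A p.

Definition nearest_on_horizontal S p q :=
  [/\ S q, q.2 = p.2 & forall r, S r -> r.2 = p.2 -> d1 p q <= d1 p r].

Definition skeleton A S : set (R * R) :=
  S `|` \bigcup_(p in A) \bigcup_(q in nearest_on_horizontal S p) segment p q.

End Plane.

(* Main.v *)
Require Import Defs.
From mathcomp Require Import lra.

(* Say that a closed quadrant at u is occupied when it contains a point of A.
   Every point u of the spine has its two upper quadrants occupied and, for each
   lower quadrant, either this one is occupied too or no point of A lies strictly
   inside the opposite one. Connecting the points of A horizontally to the spine
   and hatching vertically preserve this property, which has two consequences on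
   Y = L_y(SKELETON). Every point p of A has a point q of A such that u lies
   between p and q, so that the distances from u to A form a function in T(A).
   If v is not below u, then A meets the upper quadrant at v facing away from u,
   so that d(u, v) is a difference of distances to A, and Y -> T(A) is an
   isometric embedding.

   Conversely, a function in T(A) is the distance function to some u in the
   plane, because pairwise intersecting balls of d1 have a common point, and each
   p in A has a q in A with u between p and q. If the four quadrants at u are
   occupied, then u is in Y, as the spine is connected and climbs from the bottom
   to the top of A. Otherwise A lies in the union of two opposite quadrants at u,
   and u can be slid along a diagonal to the spine without changing its distances
   to A. *)

Set Implicit Arguments.
Unset Strict Implicit.
Unset Printing Implicit Defensive.

Import Order.TTheory GRing.Theory Num.Theory.
Local Open Scope classical_set_scope.
Local Open Scope ring_scope.

(** * Counting, betweenness and extrema on the real line *)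

Lemma count_lt (T : eqType) (a1 a2 : pred T) (s : seq T) x :
  (forall y, a1 y -> a2 y) -> x \in s -> a2 x -> ~~ a1 x ->
  (count a1 s < count a2 s)%N.
Proof.
move=> sub xs a2x a1x; elim: s xs => //= y s IH; rewrite inE => /orP[/eqP <-|/IH lt].
  by rewrite a2x (negbTE a1x) add0n add1n ltnS sub_count.
apply: leq_ltn_trans (_ : _ <= a2 y + count a1 s)%N _; last by rewrite ltn_add2l.
by rewrite leq_add2r; case: (a1 y) (sub y) => // ->.
Qed.

Section Reals.
Variable R : realType.
Implicit Types (x y z : R) (E : set R).

Definition between x y z := x <= y <= z \/ z <= y <= x.

Lemma betweenC x y z : between x y z -> between z y x.
Proof. by case; [right|left]. Qed.

(** Nothing is assumed on the position of [y]: this locates a value taken along a path through an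
    intermediate point, whatever the value at that point. *)
Lemma between_total x y z w : between x w z -> between x w y \/ between y w z.
Proof.
case=> /andP[h1 h2]; case: (lerP w y) => [|/ltW] h3.
- by left; left; rewrite h1.
- by right; left; rewrite h3.
- by right; right; rewrite h1.
- by left; right; rewrite h3.
Qed.

Lemma between_dist x y z : between x y z -> `|x - y| + `|y - z| = `|x - z|.
Proof.
by case=> /andP[h1 h2]; case: (ger0P (x - y)); case: (ger0P (y - z));
  case: (ger0P (x - z)); lra.
Qed.

Lemma dist_between x y z : `|x - y| + `|y - z| <= `|x - z| -> between x y z.
Proof.
case: (ger0P (x - y)); case: (ger0P (y - z)); case: (ger0P (x - z)) => *;
  by [left; apply/andP; split; lra|right; apply/andP; split; lra].
Qed.

Lemma finite_is_max E : finite_set E -> E !=set0 -> exists t, is_max E t.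
Proof.
move=> /finite_seqP[s ->]; elim: s => [[x]//|x s IH _].
have [s0|/set0P/IH[t [st ubt]]] := eqVneq [set` s] set0.
  exists x; split=> [|y] /=; first by rewrite inE eqxx.
  rewrite inE => /orP[/eqP->//|ys].
  by have : [set` s] y by []; rewrite s0.
exists (Num.max x t); split=> [|y] /=.
  by rewrite inE /Num.max; case: ifP; rewrite ?eqxx// st orbT.
by rewrite inE le_max => /orP[/eqP->|/ubt->]; rewrite ?lexx ?orbT.
Qed.

Lemma finite_is_min E : finite_set E -> E !=set0 -> exists t, is_min E t.
Proof.
move=> finE [x Ex].
have [||t [[y Ey <-] ubt]] := @finite_is_max (-%R @` E).
- exact: finite_image.
- by exists (- x); exists x.
exists y; split=> // z Ez; rewrite -lerN2; apply: ubt; by exists z.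
Qed.

Lemma is_max_unique E s t : is_max E s -> is_max E t -> s = t.
Proof. by move=> [Es us] [Et ut]; apply/le_anti; rewrite ut ?us. Qed.

Lemma is_min_unique E s t : is_min E s -> is_min E t -> s = t.
Proof. by move=> [Es us] [Et ut]; apply/le_anti; rewrite us ?ut. Qed.

Lemma sup_is_max E t : is_max E t -> sup E = t.
Proof.
move=> [Et ut]; apply/le_anti/andP; split.
  by apply: ge_sup => //; exists t.
by apply: ub_le_sup => //; exists t.
Qed.

Lemma smallest_intervalE E y :
  smallest (@is_interval R) E y <->
  exists x z, [/\ E x, E z & x <= y <= z].
Proof.
split=> [h|[x [z [Ex Ez xyz]]] I [/= itvI EI]]; last first.
  exact: (itvI x z (EI _ Ex) (EI _ Ez)).
apply: (h [set w | exists x z, [/\ E x, E z & x <= w <= z]]); split.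
  move=> u v [x [_ [Ex _ /andP[xu _]]]] [_ [z [_ Ez /andP[_ vz]]]] w /andP[uw wv].
  by exists x, z; split=> //; rewrite (le_trans xu) ?(le_trans wv).
by move=> w Ew; exists w, w; rewrite lexx.
Qed.

(** The boolean is a direction along an axis, [true] meaning right or up, so that mirror-image cases
    are treated at once. *)
Definition toward (e : bool) x y := if e then x <= y else y <= x.

Lemma toward_refl e x : toward e x x.
Proof. by case: e => /=. Qed.

Lemma toward_trans e x y z : toward e x y -> toward e y z -> toward e x z.
Proof. by case: e => /= h1 h2; [exact: le_trans h2|exact: le_trans h1]. Qed.

Lemma towardN e x y : toward (~~ e) x y = toward e y x.
Proof. by case: e. Qed.

Lemma toward_total e x y : toward e x y \/ toward e y x.
Proof. by case: e => /=; case: (lerP x y) => [|/ltW]; [left|right|right|left]. Qed.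

Lemma toward_exists x y : exists e, toward e x y.
Proof. by case: (toward_total true x y); [exists true|exists false]. Qed.

Lemma betweenP x y z :
  between x y z <-> exists e, toward e y x /\ toward e z y.
Proof.
split=> [[/andP[h1 h2]|/andP[h1 h2]]|[[] /= [h1 h2]]].
- by exists false.
- by exists true.
- by right; rewrite h1 h2.
- by left; rewrite h1 h2.
Qed.

Lemma toward_between e x y z : toward e x y -> toward e y z -> between x y z.
Proof.
by move=> h1 h2; apply/betweenP; exists (~~ e); rewrite !towardN.
Qed.

Lemma between_toward e x y z : between x y z -> toward e y x \/ toward e y z.
Proof.
by move=> /betweenP[e' [h1 h2]]; move: e e' h1 h2 => [] [] /=; tauto.
Qed.

End Reals.

(** * Boxes, segments and monotone curves in the Manhattan plane *)

Section Plane.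
Variable R : realType.
Implicit Types (A S T : set (R * R)) (p q u v w : R * R).

Lemma d1_ge0 p q : 0 <= d1 p q.
Proof. by rewrite addr_ge0. Qed.

Lemma d1C p q : d1 p q = d1 q p.
Proof. by rewrite /d1 distrC (distrC p.2). Qed.

Lemma d1_triangle p q r : d1 p r <= d1 p q + d1 q r.
Proof. by rewrite /d1 addrACA lerD ?ler_distD. Qed.

Lemma d1_eq0 p q : d1 p q = 0 -> p = q.
Proof.
move=> /eqP; rewrite paddr_eq0// !normr_eq0 !subr_eq0 => /andP[/eqP h1 /eqP h2].
by rewrite [p]surjective_pairing h1 h2 -surjective_pairing.
Qed.

Definition in_box p u q := between p.1 u.1 q.1 /\ between p.2 u.2 q.2.

(** The triangle inequalities of the two coordinates add up, so equality in the sum forces equality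
    in each. *)
Lemma in_boxP p u q : in_box p u q <-> d1 p u + d1 u q = d1 p q.
Proof.
rewrite /d1 addrACA; split=> [[/between_dist-> /between_dist->]//|h].
have := ler_distD u.1 p.1 q.1; have := ler_distD u.2 p.2 q.2.
by split; apply: dist_between; lra.
Qed.

Lemma segment1 p q : segment p q p.
Proof.
exists 0; first by rewrite /= in_itv /= lexx ler01.
by rewrite !subr0 !mul1r !mul0r !addr0 -surjective_pairing.
Qed.

Lemma segment2 p q : segment p q q.
Proof.
exists 1; first by rewrite /= in_itv /= lexx ler01.
by rewrite subrr !mul1r !mul0r !add0r -surjective_pairing.
Qed.

Lemma segmentC p q : segment p q = segment q p.
Proof.
suff sub u v : segment u v `<=` segment v u by apply/seteqP; split.
move=> w [l]; rewrite /= in_itv /= => /andP[l0 l1] <-.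
exists (1 - l); first by rewrite /= in_itv /=; lra.
by congr pair; lra.
Qed.

Lemma segment_in_box p q u : segment p q u -> in_box p u q.
Proof.
have conv x y l : 0 <= l <= 1 -> between x ((1 - l) * x + l * y) y.
  move=> /andP[l0 l1]; case: (lerP x y) => xy; [left|right]; apply/andP; split; nra.
by move=> [l]; rewrite /= in_itv /= => hl <-; split; apply: conv.
Qed.

Lemma between_segment (x y z : R) : between x y z ->
  exists2 l, 0 <= l <= 1 & y = (1 - l) * x + l * z.
Proof.
move=> b; have [xz|xz] := eqVneq x z.
  by exists 0; [rewrite lexx ler01|case: b => /andP[]; lra].
have d0 : z - x != 0 by rewrite subr_eq0 eq_sym.
exists ((y - x) / (z - x)); last first.
  have : (y - x) / (z - x) * (z - x) = y - x by rewrite divfK.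
  lra.
case: b => /andP[h1 h2].
  have zx : 0 < z - x by rewrite lt0r d0 subr_ge0 (le_trans h1).
  by rewrite divr_ge0 ?ler_pdivrMr//; lra.
have zx : 0 < x - z by rewrite lt0r -opprB oppr_eq0 d0 opprB subr_ge0 (le_trans h1).
rewrite -[y - x]opprB -[z - x]opprB invrN mulrNN divr_ge0 ?ler_pdivrMr//; lra.
Qed.

Lemma segment_horizontal (x1 x2 y : R) u :
  segment (x1, y) (x2, y) u <-> between x1 u.1 x2 /\ u.2 = y.
Proof.
split=> [h|[/between_segment[l hl ul] uy]].
  have [/= h1 h2] := segment_in_box h; split=> //.
  by case: h2 => /andP[]; lra.
by exists l; rewrite ?/= ?in_itv//= [u]surjective_pairing ul uy; congr pair; lra.
Qed.

Lemma segment_vertical (x y1 y2 : R) u :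
  segment (x, y1) (x, y2) u <-> between y1 u.2 y2 /\ u.1 = x.
Proof.
split=> [h|[/between_segment[l hl ul] uy]].
  have [/= h1 h2] := segment_in_box h; split=> //.
  by case: h1 => /andP[]; lra.
by exists l; rewrite ?/= ?in_itv//= [u]surjective_pairing ul uy; congr pair; lra.
Qed.

Lemma segment_convex p q u v :
  segment p q u -> segment p q v -> segment u v `<=` segment p q.
Proof.
move=> [l]; rewrite /= in_itv /= => /andP[l0 l1] <-.
move=> [m]; rewrite /= in_itv /= => /andP[m0 m1] <-.
move=> w [k]; rewrite /= in_itv /= => /andP[k0 k1] <-.
exists ((1 - k) * l + k * m); last by congr pair => /=; lra.
by rewrite /= in_itv /=; apply/andP; split; nra.
Qed.

(** Allowing all linear forms lets one intermediate value property cover the crossings of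
    horizontal, vertical and diagonal lines. *)
Definition linear_form (c : R * R) u := c.1 * u.1 + c.2 * u.2.

Lemma segment_ivt c t u v : between (linear_form c u) t (linear_form c v) ->
  exists2 w, segment u v w & linear_form c w = t.
Proof.
move=> /between_segment[l hl ->].
exists ((1 - l) * u.1 + l * v.1, (1 - l) * u.2 + l * v.2).
  by exists l; rewrite //= in_itv.
by rewrite /linear_form /=; lra.
Qed.

(* Connectedness of a curve along which the ordinate is monotone. *)
Definition monotone_ivt S := forall c t u v, S u -> S v ->
  between (linear_form c u) t (linear_form c v) ->
  exists w, [/\ S w, between u.2 w.2 v.2 & linear_form c w = t].

(** A value between those at a point [u] of [S] and a point [v] of the new segment lies between the
    values at [u] and [p], hence is taken on [S], or between those at [p] and [v], hence is taken on
    the segment. Ordinates stay monotone because [p] is a highest point of [S] and [q] is not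
    lower. *)
Lemma monotone_ivt_segment S p q : monotone_ivt S -> S p ->
  (forall u, S u -> u.2 <= p.2) -> p.2 <= q.2 ->
  monotone_ivt (S `|` segment p q).
Proof.
move=> ivtS Sp Sle pq.
have seg_ge u : segment p q u -> p.2 <= u.2.
  by move=> /segment_in_box[_ []/andP[]]; lra.
have mixed c t u v : S u -> segment p q v ->
    between (linear_form c u) t (linear_form c v) ->
    exists w, [/\ (S `|` segment p q) w, between u.2 w.2 v.2 & linear_form c w = t].
  move=> Su segv b; have up := Sle _ Su; have pv := seg_ge _ segv.
  case: (between_total (linear_form c p) b) => {}b.
    have [w [Sw uwp gw]] := ivtS _ _ _ _ Su Sp b.
    by exists w; split=> //; [left|left; case: uwp; lra].
  have [w segw gw] := segment_ivt b.
  have [_ pwv] := segment_in_box segw.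
  exists w; split=> //; last by left; case: pwv; lra.
  by right; apply: segment_convex segw => //; exact: segment1.
move=> c t u v [Su|su] [Sv|sv] b.
- by have [w [Sw ? ?]] := ivtS _ _ _ _ Su Sv b; exists w; split=> //; left.
- exact: mixed b.
- have [w [? ? ?]] := mixed _ _ _ _ Sv su (betweenC b).
  by exists w; split=> //; exact: betweenC.
- have [w segw gw] := segment_ivt b.
  have [_ uwv] := segment_in_box segw.
  by exists w; split=> //; right; apply: segment_convex segw.
Qed.

(** A substitute for closedness: it holds for every segment added to the spine and passes to
    unions. *)
Definition has_nearest S := forall p, (exists2 r, S r & r.2 = p.2) ->
  exists q, nearest_on_horizontal S p q.

Lemma has_nearestU S T :
  has_nearest S -> has_nearest T -> has_nearest (S `|` T).
Proof.
move=> nS nT p [r STr rp].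
have [[q [Sq qp hq]]|noS] := pselect (exists q, nearest_on_horizontal S p q);
  have [[q' [Tq q'p hq']]|noT] := pselect (exists q, nearest_on_horizontal T p q).
- case: (lerP (d1 p q) (d1 p q')) => [le|/ltW le].
    exists q; split=> //; first by left.
    by move=> s [/hq|/hq' h /h]; [exact|exact: le_trans].
  exists q'; split=> //; first by right.
  by move=> s [/hq h /h|/hq']; [exact: le_trans|exact].
- exists q; split=> //; first by left.
  move=> s [/hq//|Ts sp]; exfalso; apply/noT/nT; by exists s.
- exists q'; split=> //; first by right.
  move=> s [Ss sp|/hq'//]; exfalso; apply/noS/nS; by exists s.
- by case: STr => [Sr|Tr]; exfalso; [apply/noS/nS|apply/noT/nT]; exists r.
Qed.

Lemma d1_horizontal p q : q.2 = p.2 -> d1 p q = `|p.1 - q.1|.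
Proof. by rewrite /d1 => ->; rewrite subrr normr0 addr0. Qed.

Lemma has_nearest_vertical (x y1 y2 : R) : has_nearest (segment (x, y1) (x, y2)).
Proof.
move=> p [r rs rp]; exists r; split=> // s ss sp.
rewrite !d1_horizontal//.
by move: rs ss => /segment_vertical[_ ->] /segment_vertical[_ ->].
Qed.

Lemma has_nearest_horizontal (x1 x2 y : R) : has_nearest (segment (x1, y) (x2, y)).
Proof.
wlog : x1 x2 / x1 <= x2.
  by move=> h; case: (lerP x1 x2) => [|/ltW]; [|rewrite segmentC]; exact: h.
move=> x12 p [r /segment_horizontal[_ ry] rp].
(* The abscissa of [p] clamped to the interval. *)
pose x := if p.1 <= x1 then x1 else if p.1 <= x2 then p.1 else x2.
exists (x, y); split => [||s /segment_horizontal[sx sy] sp].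
- apply/segment_horizontal; split=> //; left; rewrite /x /=.
  by case: (lerP p.1 x1); case: (lerP p.1 x2); lra.
- by rewrite -rp ry.
- have {sx} /andP[s1 s2] : x1 <= s.1 <= x2 by case: sx => /andP[]; lra.
  rewrite !d1_horizontal//=; last by rewrite -rp ry.
  rewrite /x; case: (lerP p.1 x1) => h1; last case: (lerP p.1 x2) => h2.
  + by rewrite !ler0_norm; lra.
  + by rewrite subrr normr0.
  + by rewrite !ger0_norm; lra.
Qed.

(** The curve also contains the midpoint of two nearest points, on the same horizontal line. If
    these were distinct, they would lie at equal distance on both sides of [p], and the midpoint
    would be [p] itself. *)
Lemma nearest_unique S p q r : monotone_ivt S ->
  nearest_on_horizontal S p q -> nearest_on_horizontal S p r -> q = r.
Proof.
move=> ivtS [Sq qp hq] [Sr rp hr].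
have e : d1 p q = d1 p r by apply/le_anti; rewrite hq ?hr.
have [w [Sw wqr wp]] : exists w,
    [/\ S w, between q.2 w.2 r.2 & linear_form (1, 0) w = (q.1 + r.1) / 2].
  by apply: ivtS => //; rewrite /linear_form /= /between; case: (lerP q.1 r.1); lra.
have wp2 : w.2 = p.2 by case: wqr => /andP[]; rewrite qp rp; lra.
have := hq _ Sw wp2; move: e; rewrite !d1_horizontal//.
move: wp; rewrite /linear_form /= => wp e h.
rewrite [q]surjective_pairing [r]surjective_pairing qp rp; congr pair.
move: e h; case: (ger0P (p.1 - q.1)); case: (ger0P (p.1 - r.1));
  case: (ger0P (p.1 - w.1)); lra.
Qed.

End Plane.

(** * Quadrant conditions relative to A *)

Section Hull.
Variables (R : realType) (A : set (R * R)).
Implicit Types (S : set (R * R)) (p q u v w : R * R).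

Definition quadrant e h u :=
  exists p, [/\ A p, toward e u.1 p.1 & toward h u.2 p.2].

(** For f the distance function of [u], this is the condition that each p has a q with f(p) + f(q) =
    d(p, q), which for finite A singles out the tight span among the candidates. *)
Definition balanced u := forall p, A p -> exists2 q, A q & in_box p u q.

(* The invariant of the construction: it holds along the spine, and horizontal
   segments to points of A as well as vertical hatching preserve it. *)
Definition supported u := [/\ forall e, quadrant e true u,
  forall e, quadrant e false u \/ forall p, A p -> u.2 < p.2 -> toward e u.1 p.1 &
  exists2 p, A p & p.2 <= u.2].

Lemma in_box_toward e h p u q : toward e u.1 p.1 -> toward h u.2 p.2 ->
  toward (~~ e) u.1 q.1 -> toward (~~ h) u.2 q.2 -> in_box p u q.
Proof.
rewrite !towardN.
by move=> h1 h2 h3 h4; split; apply/betweenP; [exists e|exists h].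
Qed.

Lemma supported_in u : A u -> supported u.
Proof.
move=> Au; have quad e h : quadrant e h u by exists u; split=> //; exact: toward_refl.
by split=> // [e|]; [left|exists u].
Qed.

(** If [p] is not above [u], the opposite upper quadrant provides [q]. If [p] is above [u] and the
    opposite lower quadrant is empty, the second clause of [supported] forces [p] onto the vertical
    line through [u], and any point of A not above [u] serves as [q]. *)
Lemma supported_balanced u : supported u -> balanced u.
Proof.
move=> [up down [p0 Ap0 p0u]] p Ap.
have opp e : toward e u.1 p.1 -> p.2 <= u.2 -> exists2 q, A q & in_box p u q.
  move=> up1 pu2; have [q [Aq h1 h2]] := up (~~ e); exists q => //.
  exact: (@in_box_toward e false).
have oppS e : toward e u.1 p.1 -> quadrant (~~ e) false u -> u.2 <= p.2 ->
    exists2 q, A q & in_box p u q.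
  move=> h [q [Aq h1 h2]] h3; exists q => //.
  exact: (@in_box_toward e true).
have [pu2|up2] := lerP p.2 u.2.
  by have [e h] := toward_exists u.1 p.1; exact: (opp e).
have both e : toward e u.1 p.1 -> toward (~~ e) u.1 p.1 ->
    exists2 q, A q & in_box p u q.
  move=> h1 h2; case: (toward_total e u.1 p0.1) => h3.
    by apply: (oppS (~~ e)); rewrite ?negbK ?ltW//; exists p0.
  by apply: (oppS e); rewrite ?ltW//; exists p0; rewrite towardN.
have aux e : toward e u.1 p.1 -> exists2 q, A q & in_box p u q.
  move=> h; case: (down (~~ e)) => [h'|h']; first by apply: (oppS e) => //; exact: ltW.
  by apply: (both e) => //; apply: h'.
by have [e h] := toward_exists u.1 p.1; exact: (aux e).
Qed.

(** In each horizontal direction from [k] lies [p], which occupies both quadrants on that side, or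
    [q], whose conditions on that side carry over to [k]. *)
Lemma supported_horizontal p q k : A p -> supported q -> p.2 = q.2 ->
  between p.1 k.1 q.1 -> k.2 = q.2 -> supported k.
Proof.
move=> Ap [up down low] pq b kq.
have side e : toward e k.1 p.1 \/ toward e k.1 q.1 by exact: between_toward.
split=> [e|e|]; last by rewrite kq.
- case: (side e) => h; first by exists p; split=> //; rewrite kq pq toward_refl.
  have [r [Ar h1 h2]] := up e; exists r; split=> //; last by rewrite kq.
  exact: toward_trans h1.
- case: (side e) => h; first by left; exists p; split=> //; rewrite kq pq toward_refl.
  case: (down e) => [[r [Ar h1 h2]]|h1]; [left|right].
    by exists r; split=> //; [exact: toward_trans h1|rewrite kq].
  by move=> r Ar; rewrite kq => /(h1 _ Ar); exact: toward_trans.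
Qed.

(** The upper quadrants are inherited from [k2], and the two other clauses from [k1]. *)
Lemma supported_vertical k1 k2 u : supported k1 -> supported k2 ->
  k1.1 = u.1 -> k2.1 = u.1 -> k1.2 <= u.2 <= k2.2 -> supported u.
Proof.
move=> [_ down1 [p Ap p1]] [up2 _ _] e1 e2 /andP[h1 h2]; split=> [e|e|].
- have [q [Aq h3 h4]] := up2 e; exists q; split=> //; rewrite -?e2//.
  exact: le_trans h4.
- case: (down1 e) => [[q [Aq h3 h4]]|h3]; [left|right].
    by exists q; rewrite -e1; split=> //; exact: le_trans h1.
  by move=> q Aq uq; rewrite -e1; apply: h3 => //; exact: le_lt_trans uq.
- by exists p => //; exact: le_trans h1.
Qed.

Lemma supported_skeleton S k : (forall s, S s -> supported s) ->
  skeleton A S k -> supported k.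
Proof.
move=> supS [/supS//|[p Ap [q [Sq qp _] /segment_in_box[b1 b2]]]].
apply: (@supported_horizontal p q) => //; first exact: supS.
by case: b2; rewrite qp => /andP[? ?]; apply/le_anti/andP.
Qed.

Lemma vertical_hatchingP S u : vertical_hatching S u <->
  exists y z, [/\ S (u.1, y), S (u.1, z) & y <= u.2 <= z].
Proof.
split=> [[x _ [/= -> /smallest_intervalE[y [z [Sy Sz yz]]]]]|[y [z [Sy Sz yz]]]].
  by exists y, z; split=> //; [move: Sy|move: Sz]; rewrite /xsection /= inE.
exists u.1 => //; split=> //; apply/smallest_intervalE.
by exists y, z; rewrite /xsection /= !inE.
Qed.

Lemma supported_hatching S u : (forall s, S s -> supported s) ->
  vertical_hatching (skeleton A S) u -> supported u.
Proof.
move=> supS /vertical_hatchingP[y [z [/(supported_skeleton supS) sy]]].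
move=> /(supported_skeleton supS) sz yz.
exact: supported_vertical sy sz _ _ yz.
Qed.

Lemma supported_dist u v : supported u -> supported v ->
  exists2 p, A p & `|d1 u p - d1 v p| = d1 u v.
Proof.
wlog uv : u v / u.2 <= v.2 => [h su sv|_ [up _ _]].
  case: (lerP u.2 v.2) => [uv|/ltW vu]; first exact: h.
  by have [p Ap e] := h _ _ vu sv su; exists p; rewrite // distrC e d1C.
have [e uve] := toward_exists u.1 v.1.
have [p [Ap h1 h2]] := up e; exists p => //.
have /in_boxP <- : in_box u v p.
  split; first exact: toward_between h1.
  by left; rewrite uv.
by rewrite addrK ger0_norm// d1_ge0.
Qed.

End Hull.

(** * The tight span as a set of distance functions *)

Section TightSpan.
Variables (R : realType) (A : set (R * R)).
Hypotheses (A_finite : finite_set A) (A_nonempty : A !=set0).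
Implicit Types (p q : A) (u v w : R * R) (f g : A -> R).

Let d p q := d1 (\val p) (\val q).

Definition dist_fun u : A -> R := fun p => d1 u (\val p).

Lemma memA p : A (\val p).
Proof. exact: set_valP. Qed.

Lemma liftA u : A u -> exists p, \val p = u.
Proof. by move=> /mem_set Au; exists (SigSub Au). Qed.

Lemma dist_fun_candidate u : tight_span_candidate d (dist_fun u).
Proof.
split=> [p|p q]; first exact: d1_ge0.
by rewrite /dist_fun [d1 u (\val p)]d1C; exact: d1_triangle.
Qed.

(** The point [q] paired with [p] makes the inequality tight, so a candidate that does not increase
    the value at [q] cannot decrease it at [p]. *)
Lemma dist_fun_tight_span u : balanced A u -> tight_span d (dist_fun u).
Proof.
move=> bu; split; first exact: dist_fun_candidate.
move=> [g [[g0 gd] gne gle]]; apply: gne; apply/funext => p.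
apply/le_anti; rewrite gle /=.
have [q Aq] := bu _ (memA p); have [q' <-] := liftA Aq.
move=> /in_boxP; rewrite d1C => e.
by have := gd p q'; have := gle q'; rewrite /d /dist_fun; lra.
Qed.

Lemma finite_image_max f : exists p, forall q, f q <= f p.
Proof.
have [t [[p _ <-] ub]] : exists t, is_max (range f) t.
  apply: finite_is_max.
    (* [f] is extended to the plane by the arbitrary value 0, so that its range sits in the image of
       the finite set A. *)
    pose F x := if pselect (A x) is left Ax then f (SigSub (mem_set Ax)) else 0.
    apply: (@sub_finite_set _ _ (F @` A)); last exact: finite_image.
    move=> _ [p _ <-]; exists (\val p); first exact: memA.
    rewrite /F; case: pselect => [Ap|/(_ (memA p))//].
    by congr f; exact: val_inj.
  by have [p /liftA[p' _]] := A_nonempty; exists (f p'), p'.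
by exists p => q; apply: ub; exists q.
Qed.

(** If no inequality at [p] were tight, the value at [p] could be lowered, finiteness leaving a
    positive margin. *)
Lemma tight_span_balanced f : tight_span d f ->
  forall p, exists q, f p + f q = d p q.
Proof.
move=> [[f0 fd] fmin] p; apply: contrapT => noq; apply: fmin.
have lt q : d p q < f p + f q.
  by rewrite lt_def fd andbT; apply/eqP => e; apply: noq; exists q.
have [q0 q0P] := finite_image_max (fun q => d p q - f q).
(* The least value allowed at [p] when the other values are kept. *)
pose m := Num.max 0 (d p q0 - f q0).
have m0 : 0 <= m by rewrite /m le_max lexx.
have mq q : d p q - f q <= m by rewrite /m le_max q0P orbT.
have dpp : d p p = 0 by rewrite /d /d1 !subrr normr0 addr0.
have mfp : m < f p.
  by rewrite /m gt_max; have := lt p; have := lt q0; rewrite dpp => *; apply/andP; split; lra.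
exists (fun q => if q == p then m else f q); split.
- split=> [q|q r]; first by case: ifP.
  have [->|qp] := eqVneq q p; have [->|rp] := eqVneq r p => //.
  + by rewrite dpp addr_ge0.
  + by have := mq r; lra.
  + by have := mq q; rewrite /d (d1C (\val q)); lra.
- by move=> e; move: mfp; rewrite -e eqxx ltxx.
- by move=> q; case: eqVneq => [->|//]; exact: ltW.
Qed.

(* In the coordinates x + y and x - y the balls are squares, and pairwise
   intersecting intervals have a common point. *)
Lemma tight_span_center f : tight_span_candidate d f ->
  exists u, forall p, dist_fun u p <= f p.
Proof.
move=> [f0 fd].
have center (c : R * R) : `|c.1| = 1 -> `|c.2| = 1 ->
    exists t, forall p : A, `|linear_form c (\val p) - t| <= f p.
  move=> c1 c2.
  have [p0 p0P] := finite_image_max (fun p => linear_form c (\val p) - f p).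
  (* The largest left endpoint of the intervals; pairwise intersection puts it before every right
     endpoint. *)
  exists (linear_form c (\val p0) - f p0) => p.
  have := p0P p; have := fd p0 p; rewrite /d /d1 /linear_form ler_norml.
  have h1 := ler_norm (c.1 * ((\val p0).1 - (\val p).1)).
  have h2 := ler_norm (c.2 * ((\val p0).2 - (\val p).2)).
  rewrite !normrM c1 c2 !mul1r in h1 h2.
  by move=> h3 h4; apply/andP; split; lra.
have [s sP] := center (1, 1) (normr1 _) (normr1 _).
have [t tP] := center (1, -1) (normr1 _) (normrN1 _).
exists ((s + t) / 2, (s - t) / 2) => p.
have := sP p; have := tP p; rewrite /linear_form /dist_fun /d1 /= !ler_norml.
move=> /andP[h1 h2] /andP[h3 h4].
case: (ger0P ((s + t) / 2 - (\val p).1)); case: (ger0P ((s - t) / 2 - (\val p).2)); lra.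
Qed.

(** The distance function of the center is a candidate below [f], hence equals [f] by minimality. *)
Lemma tight_span_dist_fun f : tight_span d f ->
  exists2 u, balanced A u & f = dist_fun u.
Proof.
move=> tf; have [u uP] := tight_span_center tf.1.
have fE : f = dist_fun u.
  apply: contrapT => ne; apply: tf.2; exists (dist_fun u); split=> //.
    exact: dist_fun_candidate.
  by move=> e; apply: ne.
exists u => // p /liftA[p' <-].
have [q e] := tight_span_balanced tf p'; exists (\val q); first exact: memA.
by apply/in_boxP; rewrite (d1C _ u); move: e; rewrite fE.
Qed.

Lemma dist_infty_dist_fun u v : supported A u -> supported A v ->
  dist_infty (dist_fun u) (dist_fun v) = d1 u v.
Proof.
move=> su sv; apply: sup_is_max; split.
  have [p /liftA[p' <-] e] := supported_dist su sv.
  by exists p'.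
move=> _ [p _ <-]; rewrite /dist_fun ler_norml.
have := d1_triangle u v (\val p); have := d1_triangle v u (\val p).
by rewrite (d1C v u); lra.
Qed.

(** The first hypothesis makes [dist_fun] an isometric embedding of [Y] into the tight span, and the
    second makes it surjective. *)
Lemma isometric_tight_span (Y : set (R * R)) :
  (forall u, Y u -> supported A u) ->
  (forall u, balanced A u -> exists2 v, Y v & forall p : R * R, A p -> d1 v p = d1 u p) ->
  isometric (@d1 R) (@dist_infty R A) Y (tight_span d).
Proof.
move=> supY domY; exists dist_fun; last first.
  by move=> u v /supY su /supY sv; exact: dist_infty_dist_fun.
split.
- by move=> u /supY/supported_balanced; exact: dist_fun_tight_span.
- move=> u v /set_mem/supY su /set_mem/supY sv e; apply: d1_eq0.
  rewrite -dist_infty_dist_fun// e /dist_infty.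
  apply: sup_is_max; split.
    have [p /liftA[p' _]] := A_nonempty; exists p' => //.
    by rewrite subrr normr0.
  by move=> _ [p _ <-]; rewrite subrr normr0.
- move=> f /tight_span_dist_fun[u bu ->].
  have [v Yv vu] := domY _ bu; exists v => //.
  by apply/funext => p; apply: vu; exact: memA.
Qed.

End TightSpan.

(** * Termination and invariant of the spine construction *)

Section Algorithm.
Variables (R : realType) (A : set (R * R)).
Hypothesis A_finite : finite_set A.
Implicit Types (S : set (R * R)) (p q r u v w : R * R).

Lemma start_point_exists_unique : A !=set0 -> exists! p, start_point A p.
Proof.
move=> A0; have [||y [[p Ap <-] miny]] := @finite_is_min _ [set q.2 | q in A].
- exact: finite_image.
- by have [p Ap] := A0; exists p.2, p.
pose B := [set q | A q /\ q.2 = p.2].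
have [||x [[q [Aq qp] <-] minx]] := @finite_is_min _ [set q.1 | q in B].
- by apply: finite_image; apply: sub_finite_set A_finite => r [].
- by exists p.1, p.
exists q; split=> [|r [Ar rmin]].
  split=> // r Ar; rewrite qp; split=> [|rp]; first by apply: miny; exists r.
  by apply: minx; exists r.
have rp : r.2 = p.2.
  by apply/le_anti/andP; split; [case: (rmin _ Ap)|apply: miny; exists r].
rewrite [q]surjective_pairing [r]surjective_pairing qp rp; congr pair.
apply/le_anti/andP; split; first by apply: minx; exists r.
by apply: (rmin _ Aq).2; rewrite qp.
Qed.

Lemma above_right_finite p : finite_set (above_right A p).
Proof. by apply: sub_finite_set A_finite => q []. Qed.

Lemma above_left_finite p : finite_set (above_left A p).
Proof. by apply: sub_finite_set A_finite => q []. Qed.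

(** The height reached is that of a point [r] of A, which thereby ceases to be above the current
    point. *)
Lemma step_up_exists p S : above_right A p !=set0 -> above_left A p !=set0 ->
  exists s, spine_step A (p, S) s /\ exists r, [/\ A r, p.2 < r.2 & r.2 = s.1.2].
Proof.
case: p => a b r0 l0.
have [||t1 max1] := @finite_is_max _ [set q.2 - b | q in above_right A (a, b)].
- exact/finite_image/above_right_finite.
- by have [q hq] := r0; exists (q.2 - b), q.
have [||t2 max2] := @finite_is_max _ [set q.2 - b | q in above_left A (a, b)].
- exact/finite_image/above_left_finite.
- by have [q hq] := l0; exists (q.2 - b), q.
exists ((a, b + Num.min t1 t2), S `|` segment (a, b) (a, b + Num.min t1 t2)).
split; first exact: spine_step_up.
case: max1 max2 => [[q1 [Aq1 bq1 _] <-] _] [[q2 [Aq2 bq2 _] <-] _].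
by case: (lerP (q1.2 - b) (q2.2 - b)) => _; [exists q1|exists q2]; split=> //=; lra.
Qed.

(** A point attaining the minimum ends up vertically above the new position and so counts on both
    sides: the next step goes up. *)
Lemma step_right_exists p S : above_right A p !=set0 -> ~ (above_left A p !=set0) ->
  exists s, [/\ spine_step A (p, S) s, s.1.2 = p.2,
    above_right A s.1 !=set0 & above_left A s.1 !=set0].
Proof.
case: p => a b r0 l0.
have [||t mint] := @finite_is_min _ [set q.1 - a | q in above_right A (a, b)].
- exact/finite_image/above_right_finite.
- by have [q hq] := r0; exists (q.1 - a), q.
exists ((a + t, b), S `|` segment (a, b) (a + t, b)).
split=> //; first exact: spine_step_right.
- by case: mint => [[q [Aq bq _] <-] _]; exists q; split=> //=; lra.
- by case: mint => [[q [Aq bq _] <-] _]; exists q; split=> //=; lra.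
Qed.

Lemma step_left_exists p S : above_left A p !=set0 -> ~ (above_right A p !=set0) ->
  exists s, [/\ spine_step A (p, S) s, s.1.2 = p.2,
    above_right A s.1 !=set0 & above_left A s.1 !=set0].
Proof.
case: p => a b l0 r0.
have [||t mint] := @finite_is_min _ [set a - q.1 | q in above_left A (a, b)].
- exact/finite_image/above_left_finite.
- by have [q hq] := l0; exists (a - q.1), q.
exists ((a - t, b), S `|` segment (a - t, b) (a, b)).
split=> //; first exact: spine_step_left.
- by case: mint => [[q [Aq bq _] <-] _]; exists q; split=> //=; lra.
- by case: mint => [[q [Aq bq _] <-] _]; exists q; split=> //=; lra.
Qed.

Lemma not_done_above p : ~ spine_done A p ->
  above_right A p !=set0 \/ above_left A p !=set0.
Proof.
move=> /contrapT[q [Aq pq]].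
by case: (lerP p.1 q.1) => [|/ltW] h; [left|right]; exists q.
Qed.

Lemma spine_step_exists s : ~ spine_done A s.1 -> exists s', spine_step A s s'.
Proof.
case: s => p S /= /not_done_above above.
have [r0|r0] := pselect (above_right A p !=set0);
  have [l0|l0] := pselect (above_left A p !=set0).
- by have [s [h _]] := step_up_exists S r0 l0; exists s.
- by have [s [h _ _ _]] := step_right_exists S r0 l0; exists s.
- by have [s [h _ _ _]] := step_left_exists S l0 r0; exists s.
- by case: above.
Qed.

Lemma spine_step_unique s s1 s2 :
  spine_step A s s1 -> spine_step A s s2 -> s1 = s2.
Proof.
suff uniq s' : spine_step A s s1 -> spine_step A s' s2 -> s = s' -> s1 = s2.
  by move=> h1 h2; exact: uniq h1 h2 _.
case=> [a b S t1 t2 r0 l0 m1 m2 t|a b S t r0 l0 m|a b S t l0 r0 m];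
case=> [a' b' S' t1' t2' r0' l0' m1' m2' t'|a' b' S' t' r0' l0' m'|a' b' S' t' l0' r0' m']
  [? ? ?]; subst => //.
- by rewrite /t /t' (is_max_unique m1 m1') (is_max_unique m2 m2').
- by rewrite (is_min_unique m m').
- by rewrite (is_min_unique m m').
Qed.

(** Induction on the number of points of A above the current point. A horizontal step does not
    change it, so it is taken together with the upward step that follows. *)
Lemma spine_exists : A !=set0 -> exists S, spine A S.
Proof.
move=> /start_point_exists_unique[p0 [startp0 _]].
have /finite_seqP[l AE] := A_finite.
pose above p := count (fun q : R * R => p.2 < q.2) l.
suff ind n s : (above s.1 < n)%N -> spine_reachable A s -> exists S, spine A S.
  apply: (ind (above p0).+1 (p0, [set p0])) => //.
  by exists p0 => //; exact: rt_refl.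
elim: n s => // n IH [p S] /= pn reach.
have next s s' : spine_reachable A s -> spine_step A s s' -> spine_reachable A s'.
  by move=> [q sq rq] ss'; exists q => //; apply: rt_trans rq _; exact: rt_step.
have up s : spine_reachable A s -> s.1.2 = p.2 -> above_right A s.1 !=set0 ->
    above_left A s.1 !=set0 -> exists S, spine A S.
  case: s => q T reach_q qp r0 l0.
  have [s' [step [r [Ar qr rs']]]] := step_up_exists T r0 l0.
  apply: (IH s'); last exact: next step.
  rewrite -ltnS; apply: leq_trans pn; rewrite ltnS.
  apply: (@count_lt _ _ _ _ r); last by rewrite rs' ltxx.
  - by move=> v; apply: lt_trans; rewrite -rs' -qp.
  - by move: Ar; rewrite AE.
  - by rewrite -qp.
have [done|/not_done_above above_p] := pselect (spine_done A p).
  by exists S, p.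
have [r0|r0] := pselect (above_right A p !=set0);
  have [l0|l0] := pselect (above_left A p !=set0).
- exact: (up (p, S)).
- have [s [step sp r1 l1]] := step_right_exists S r0 l0.
  exact: (up s) (next _ _ reach step) _ _ _.
- have [s [step sp r1 l1]] := step_left_exists S l0 r0.
  exact: (up s) (next _ _ reach step) _ _ _.
- by case: above_p.
Qed.

(** The current point being a highest point of the spine is what allows appending the next
    segment. *)
Definition spine_invariant (s : (R * R) * set (R * R)) :=
  [/\ s.2 s.1, forall u, s.2 u -> supported A u, forall u, s.2 u -> u.2 <= s.1.2,
    monotone_ivt s.2 & has_nearest s.2].

Lemma invariant_extend p q S : spine_invariant (p, S) -> p.2 <= q.2 ->
  (forall u, segment p q u -> supported A u) -> has_nearest (segment p q) ->
  spine_invariant (q, S `|` segment p q).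
Proof.
move=> [/= Sp sup le ivt near] pq sup' near'; split=> /=.
- by right; exact: segment2.
- by move=> u [/sup|/sup'].
- move=> u [/le up|/segment_in_box[_ [] /andP[]]]; last 2 first.
  + by [].
  + by move=> ? up; exact: le_trans pq.
  exact: le_trans pq.
- exact: monotone_ivt_segment.
- exact: has_nearestU.
Qed.

Lemma supported_up p u : supported A p -> u.1 = p.1 -> p.2 <= u.2 ->
  (forall e, quadrant A e true u) -> supported A u.
Proof.
move=> [_ down [r Ar rp]] u1 pu up; split=> // [e|]; last first.
  by exists r => //; exact: le_trans pu.
case: (down e) => [[q [Aq h1 h2]]|h]; [left|right].
  by exists q; rewrite u1; split=> //; exact: le_trans pu.
by move=> q Aq uq; rewrite u1; apply: h => //; exact: le_lt_trans uq.
Qed.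

(** Behind [p] nothing of A is strictly higher, so the upper quadrant there is occupied by a point
    [q0] at the height of [p], which occupies both rear quadrants at [u]. In front, [r] occupies the
    upper quadrant, and no point strictly above [u] is behind it. *)
Lemma supported_turn e p q u : supported A p -> p.2 = q.2 ->
  toward e p.1 q.1 ->
  (forall r, A r -> p.2 < r.2 -> ~ toward (~~ e) p.1 r.1) ->
  (exists r, [/\ A r, p.2 < r.2 & r.1 = q.1]) ->
  (forall r, A r -> p.2 < r.2 -> toward e q.1 r.1) ->
  segment p q u -> supported A u.
Proof.
have cases e' : e' = e \/ e' = ~~ e by case: e' e => [] []; [left|right|right|left].
move=> [up down [p1 Ap1 p1p]] pq epq noback [r [Ar pr rq]] fwd.
rewrite [p]surjective_pairing [q]surjective_pairing -pq.
move=> /segment_horizontal[b u2].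
have [pu uq] : toward e p.1 u.1 /\ toward e u.1 q.1.
  by case: e epq {noback fwd cases} => /= pq1; case: b; lra.
have [q0 [Aq0 eq0 q0p]] := up (~~ e).
have {}q0p : q0.2 = p.2.
  apply/le_anti/andP; split=> //; rewrite leNgt; apply/negP => lt.
  exact: noback eq0.
have back : toward (~~ e) u.1 q0.1 by apply: toward_trans eq0; rewrite towardN.
split=> [e'|e'|]; last by exists p1; rewrite ?u2.
- by case: (cases e') => ->; [exists r|exists q0]; split=> //; rewrite ?rq//= u2 ?q0p// ltW.
- case: (cases e') => ->; last by left; exists q0; split=> //=; rewrite u2 q0p.
  by right=> v Av; rewrite u2 => /(fwd _ Av); exact: toward_trans.
Qed.

Lemma spine_step_invariant s s' :
  spine_step A s s' -> spine_invariant s -> spine_invariant s'.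
Proof.
case=> [a b S t1 t2 _ _ [[q1 [Aq1 bq1 aq1] e1] _] [[q2 [Aq2 bq2 aq2] e2] _] t
  |a b S t _ l0 [[q [Aq bq aq] eq] min]|a b S t _ r0 [[q [Aq bq aq] eq] min]] inv;
  have [/= Sp /(_ _ Sp) sup _ _ _] := inv.
(* As [t] is the smaller maximum, the points attaining the two maxima are never below the segment
   and occupy its upper quadrants. *)
- have [tt1 tt2] : t <= t1 /\ t <= t2 by rewrite /t !ge_min !lexx orbT.
  have t0 : 0 <= t by rewrite /t le_min -e1 -e2 !subr_ge0 !ltW.
  apply: invariant_extend; [exact: inv|by rewrite /= lerDl| |exact: has_nearest_vertical].
  move=> u /segment_vertical[bu u1].
  have {bu} /andP[bu ub] : b <= u.2 <= b + t by case: bu => // /andP[]; lra.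
  apply: (supported_up sup u1 bu) => -[].
    by exists q1; rewrite /toward u1; split=> //; lra.
  by exists q2; rewrite /toward u1; split=> //; lra.
- apply: invariant_extend; [exact: inv|exact: lexx| |exact: has_nearest_horizontal].
  move=> u; apply: (@supported_turn true) => //=.
  + by move: aq => /=; lra.
  + by move=> r Ar br ra; apply: l0; exists r.
  + by exists q; split=> //; rewrite -eq; lra.
  + move=> r Ar br; rewrite -lerBrDl; apply: min; exists r => //; split=> //=.
    by case: (lerP a r.1) => // /ltW ra; case: l0; exists r.
- rewrite segmentC.
  apply: invariant_extend; [exact: inv|exact: lexx| |exact: has_nearest_horizontal].
  move=> u; apply: (@supported_turn false) => //=.
  + by move: aq => /=; lra.
  + by move=> r Ar br ra; apply: r0; exists r.
  + by exists q; split=> //; rewrite -eq; lra.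
  + move=> r Ar br; rewrite lerBrDl -lerBrDr; apply: min; exists r => //; split=> //=.
    by case: (lerP r.1 a) => // /ltW ra; case: r0; exists r.
Qed.

Lemma spine_invariant_reachable s : spine_reachable A s ->
  spine_invariant s /\ exists2 p, start_point A p & s.2 p.
Proof.
move=> [p startp reach].
pose good (t : (R * R) * set (R * R)) := spine_invariant t /\ t.2 p.
suff : good s by move=> [? ?]; split=> //; exists p.
have : good (p, [set p]).
  split=> //; split=> //= [u ->|u ->||].
  - by apply: supported_in; case: startp.
  - exact: lexx.
  - move=> c t u v -> -> b; exists p; split=> //; first by left; rewrite lexx.
    by case: b => /andP[? ?]; apply/le_anti/andP.
  - by move=> q [r -> pq]; exists p; split=> // r' ->.
elim: reach => // [{}s s' step [inv sp]|s1 s2 s3 _ IH1 _ IH2 /IH1/IH2//].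
split; first exact: spine_step_invariant step inv.
by case: step sp => *; left.
Qed.

End Algorithm.

(** * Balanced points have the same distances to A as points of the hatched skeleton *)

Section Domination.
Variables (R : realType) (A S : set (R * R)).
Hypotheses (A_nonempty : A !=set0) (S_spine : spine A S).
Implicit Types (p q r u v w : R * R).

Lemma spine_supported u : S u -> supported A u.
Proof. by have [p /spine_invariant_reachable[[_ + _ _ _] _] _] := S_spine; apply. Qed.

Lemma spine_ivt : monotone_ivt S.
Proof. by have [p /spine_invariant_reachable[[]]] := S_spine. Qed.

Lemma spine_bottom : exists p, [/\ A p, S p & forall q, A q -> p.2 <= q.2].
Proof.
have [p /spine_invariant_reachable[_ [q [Aq h] Sq]] _] := S_spine.
by exists q; split=> // r /h[].
Qed.

Lemma spine_top : exists2 p, S p & forall q, A q -> q.2 <= p.2.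
Proof.
have [p /spine_invariant_reachable[[Sp _ _ _ _] _] done] := S_spine.
by exists p => // q Aq; rewrite leNgt; apply/negP => pq; apply: done; exists q.
Qed.

Lemma spine_height q r y : A q -> A r -> q.2 <= y <= r.2 -> exists2 s, S s & s.2 = y.
Proof.
move=> Aq Ar /andP[qy yr].
have [p [_ Sp bot]] := spine_bottom; have [p' Sp' top] := spine_top.
have := @spine_ivt (0, 1) y p p' Sp Sp'; rewrite /linear_form /= !mul0r !mul1r !add0r.
case=> [|s [Ss _ <-]]; last by exists s => //; rewrite mul0r mul1r add0r.
by left; rewrite (le_trans (bot _ Aq))//= (le_trans yr) ?top.
Qed.

Lemma spine_nearest p : A p -> exists q, nearest_on_horizontal S p q.
Proof.
have [p0 /spine_invariant_reachable[[_ _ _ _ near] _] _] := S_spine.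
move=> Ap; apply: near.
by have [|s Ss sp] := @spine_height p p p.2 Ap Ap; [rewrite lexx|exists s].
Qed.

Let K := skeleton A S.

(** If the spine point [q] nearest to [p] is on the same side of [u] as [s], the connecting segment
    from [p] crosses the vertical line through [u]. Otherwise the spine crosses it between [s] and
    [q]. *)
Lemma skeleton_reaches s u e h : S s -> s.2 = u.2 -> toward e s.1 u.1 ->
  quadrant A e h u -> exists y, K (u.1, y) /\ toward h u.2 y.
Proof.
move=> Ss su esu [p [Ap eup hup]].
have [q np] := spine_nearest Ap; have [Sq qp _] := np.
case: (toward_total e q.1 u.1) => equ.
  exists p.2; split=> //; right; exists p => //; exists q => //.
  rewrite segmentC [p]surjective_pairing [q]surjective_pairing qp.
  by apply/segment_horizontal; split=> //=; exact: toward_between eup.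
have [|w [Sw sw]] := @spine_ivt (1, 0) u.1 s q Ss Sq.
  by rewrite /linear_form /= !mul0r !mul1r !addr0; exact: toward_between equ.
rewrite /linear_form /= mul0r mul1r addr0 => wu.
exists w.2; split; first by left; rewrite -wu -surjective_pairing.
move: sw; rewrite su qp; case: h hup => /= hup; case=> /andP[]; lra.
Qed.

Lemma quadrants_hatching u : (forall e h, quadrant A e h u) -> vertical_hatching K u.
Proof.
move=> quad.
have [p [Ap _ up]] := quad true true; have [q [Aq _ qu]] := quad true false.
have [|s Ss su] := @spine_height q p u.2 Aq Ap; first exact/andP.
have [e esu] := toward_exists s.1 u.1.
have [y [Ky yu]] := skeleton_reaches Ss su esu (quad e false).
have [z [Kz uz]] := skeleton_reaches Ss su esu (quad e true).
by apply/vertical_hatchingP; exists y, z; split=> //; apply/andP.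
Qed.

Definition sign (e : bool) : R := if e then 1 else -1.

(* When an off-diagonal quadrant at u misses A, all of A lies in two opposite
   quadrants, and moving u along the level set of [e x + y] through u does not
   change the distances to A as long as these two quadrants keep covering A.
   The point w where the spine meets this level set will do. *)
Lemma diagonal_spine e u :
  (forall p, A p -> toward e u.1 p.1 /\ u.2 <= p.2 \/
                    toward e p.1 u.1 /\ p.2 <= u.2) ->
  quadrant A e true u -> quadrant A (~~ e) false u ->
  ~ (quadrant A e false u /\ quadrant A (~~ e) true u) ->
  exists2 w, S w & forall p, A p -> d1 w p = d1 u p.
Proof.
move=> diag [p1 [Ap1 eup1 up1]] [p2 [Ap2 eup2 up2]] miss.
rewrite towardN in eup2.
have [s0 [As0 Ss0 bot]] := spine_bottom; have [s1 Ss1 top] := spine_top.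
(* The spine points [s0] and [s1] lie in the lower and the upper of the two quadrants: otherwise two
   points of A at the height of [u] would occupy both off-diagonal quadrants. So the spine crosses
   the level set. *)
have low : toward e s0.1 u.1 /\ s0.2 <= u.2.
  case: (diag _ As0) => // -[h1 h2]; exfalso; apply: miss.
  have s0u : s0.2 <= u.2 by exact: le_trans (bot _ Ap2) up2.
  split; [exists s0; split=> //|exists p2; split; rewrite ?towardN//].
  exact: le_trans h2 (bot _ Ap2).
have high : toward e u.1 s1.1 /\ u.2 <= s1.2.
  have us1 : u.2 <= s1.2 by exact: le_trans up1 (top _ Ap1).
  split=> //; have [up _ _] := spine_supported Ss1.
  have [r [Ar h1 h2]] := up (~~ e); rewrite towardN in h1.
  case: (diag _ Ar) => -[h3 h4]; first exact: toward_trans h3 h1.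
  exfalso; apply: miss; split.
    by exists p1; split=> //; apply: le_trans (top _ Ap1) _; exact: le_trans h4.
  by exists r; split; rewrite ?towardN//; exact: le_trans h2.
have [|w [Sw _ wu]] := @spine_ivt (sign e, 1) (linear_form (sign e, 1) u) s0 s1 Ss0 Ss1.
  left; rewrite /linear_form /= /sign.
  by case: e low high {diag eup1 eup2 miss} => /= -[? ?] [? ?]; lra.
exists w => //.
have [up down _] := spine_supported Sw.
(* If [w] were above [u], a point of A in its upper quadrant away from direction [e] would lie
   strictly inside an off-diagonal quadrant at [u]. *)
have off : toward e u.1 w.1 /\ w.2 <= u.2.
  case: (lerP w.2 u.2) => [wu2|uw2].
    split=> //; move: wu; rewrite /linear_form /sign /=.
    by case: e {diag eup1 eup2 miss low high} => /=; lra.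
  have [r [Ar h1 h2]] := up (~~ e); rewrite towardN in h1.
  have ur2 : u.2 < r.2 by exact: lt_le_trans h2.
  case: (diag _ Ar) => -[h3 h4]; last by move: ur2; rewrite ltNge h4.
  exfalso; move: (toward_trans h3 h1) wu; rewrite /linear_form /sign /=.
  by case: e {diag eup1 eup2 miss low high h1 h3 up down} => /=; lra.
have [wu1|wu2] := eqVneq w.2 u.2.
  have wE : w = u.
    rewrite [w]surjective_pairing [u]surjective_pairing wu1; congr pair.
    move: wu; rewrite /linear_form /sign /= wu1.
    by case: e {diag eup1 eup2 miss low high up down off} => /=; lra.
  by rewrite wE.
have w2 : w.2 < u.2 by rewrite lt_def eq_sym wu2; case: off.
have back : ~ toward e w.1 u.1.
  move: wu; rewrite /linear_form /sign /=.
  by case: e {diag eup1 eup2 miss low high up down off} => /=; lra.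
(* A point in the lower quadrant at [w] in direction [e] would lie strictly inside the other
   off-diagonal quadrant, so the second clause of [supported] applies. *)
have fwd p : A p -> w.2 < p.2 -> toward e w.1 p.1.
  case: (down e) => [[r [Ar h1 h2]]|]; last exact.
  exfalso; apply: back; case: (diag _ Ar) => -[h3 h4]; last exact: toward_trans h3.
  by move: w2; rewrite ltNge (le_trans h4).
(* In both cases, moving from [u] to [w] changes the two coordinate distances to [p] by opposite
   amounts. *)
move=> p Ap; have [wp|pw] := ltrP w.2 p.2.
  have wp1 := fwd _ Ap wp; have up1' : toward e u.1 p.1.
    by apply: toward_trans wp1; case: off.
  have up2' : u.2 <= p.2.
    case: (diag _ Ap) => -[] // h1 _; exfalso; apply: back; exact: toward_trans h1.
  move: wu; rewrite /d1 /linear_form /sign /= (distrC w.2) (distrC u.2).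
  rewrite !(@ger0_norm _ (p.2 - _)) ?subr_ge0 ?(ltW wp)//.
  case: e wp1 up1' {diag eup1 eup2 miss low high up down off back fwd} => /= h1 h2.
    by rewrite !ler0_norm ?subr_le0//; lra.
  by rewrite !ger0_norm ?subr_ge0//; lra.
have pu1 : toward e p.1 u.1.
  case: (diag _ Ap) => -[] // _ h1.
  by move: w2; rewrite ltNge (le_trans h1).
have pw1 : toward e p.1 w.1 by apply: toward_trans pu1 _; case: off.
have pu2 : p.2 <= u.2 by exact: le_trans pw (ltW w2).
move: wu; rewrite /d1 /linear_form /sign /= !(@ger0_norm _ (_ - p.2)) ?subr_ge0//.
case: e pw1 pu1 {diag eup1 eup2 miss low high up down off back fwd} => /= h1 h2.
  by rewrite !ger0_norm ?subr_ge0//; lra.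
by rewrite !ler0_norm ?subr_le0//; lra.
Qed.

(** If a quadrant misses A, the pairs of points having [u] between them cannot occupy it and its
    opposite, so all of A lies in the two other quadrants. *)
Lemma balanced_hatching u : balanced A u ->
  exists2 v, vertical_hatching K v & forall p, A p -> d1 v p = d1 u p.
Proof.
move=> bu.
have [quad|] := pselect (forall e h, quadrant A e h u).
  by exists u => //; exact: quadrants_hatching.
move=> /existsNP[e0 /existsNP[h0 miss0]].
(* [e] is chosen so that the missing quadrant is one of the two named in [diagonal_spine]. *)
have [e miss] : exists e, ~ (quadrant A e false u /\ quadrant A (~~ e) true u).
  by case: h0 miss0 => miss0; [exists (~~ e0)|exists e0]; rewrite ?negbK; tauto.
have diag p : A p ->
    [/\ toward e u.1 p.1 /\ u.2 <= p.2 \/ toward e p.1 u.1 /\ p.2 <= u.2,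
        quadrant A e true u & quadrant A (~~ e) false u].
  move=> Ap; have [q Aq [/betweenP[e' [h1 h2]] /betweenP[h [h3 h4]]]] := bu _ Ap.
  have Qp : quadrant A e' h u by exists p.
  have Qq : quadrant A (~~ e') (~~ h) u by exists q; rewrite !towardN.
  by case: e e' h miss Qp Qq h1 h2 h3 h4 => [] [] [] //= miss Qp Qq h1 h2 h3 h4;
    (split=> //; tauto) || (exfalso; apply: miss; split).
have [p0 Ap0] := A_nonempty; have [_ q1 q2] := diag _ Ap0.
have [|w Sw wu] := @diagonal_spine e u _ q1 q2 miss; first by move=> p /diag[].
exists w => //; apply/vertical_hatchingP; exists w.2, w.2.
by rewrite lexx -surjective_pairing; split=> //; left.
Qed.

End Domination.

Theorem theorem2 (R : realType) (A : set (R * R))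
    (A_finite : finite_set A) (A_nonempty : A !=set0) :
  [/\ exists! p, start_point A p,
      forall s, spine_reachable A s -> ~ spine_done A s.1 ->
        exists! s', spine_step A s s',
      exists S, spine A S,
      forall S, spine A S ->
        forall p, A p -> exists! q, nearest_on_horizontal S p q &
      forall S, spine A S ->
        isometric (@d1 R) (@dist_infty R A)
          (vertical_hatching (skeleton A S))
          (tight_span (fun p q : A => d1 (\val p) (\val q)))].
Proof.
split.
- exact: start_point_exists_unique.
- move=> s _ /(spine_step_exists A_finite)[s' ss']; exists s'; split=> // s''.
  exact: spine_step_unique.
- exact: spine_exists.
- move=> S spS p /(spine_nearest spS)[q hq]; exists q; split=> // r.
  exact: nearest_unique (spine_ivt spS) hq.
- move=> S spS; apply: isometric_tight_span => // u.
    exact/supported_hatching/spine_supported.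
  exact: balanced_hatching.
Qed.
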